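(* Let $k\ge2$ be even, $n\in\mathbb N$, $\epsilon\in(0,1)$, and let $\mathcal W$ be a family of channels from $[k]$ to a finite set $\mathcal Y$. There is a universal constant $C>0$ such that, whenever \[n\le C\cdot\frac{k^{3/2}}{\epsilon^2\max_{W\in\mathcal W}\|H(W)\|_*},\] the $(n,\epsilon)$-maxmin decoupled chi-square fluctuation satisfies \[\underline{\chi}^{(2)}(\mathcal W^n,\epsilon)=O\!\left(\frac{n^2\epsilon^4}{k^3}\cdot\max_{W\in\mathcal W}\|H(W)\|_*^2\right),\] with a universal implied constant.
   Context: A channel $W$ from $[k]$ to $\mathcal Y$ is a stochastic matrix with entries $W(y\mid x)$; for a distribution $\mathbf p$ on $[k]$, $\mathbf p^W(y)=\sum_x\mathbf p(x)W(y\mid x)$. $\mathbf u$ is the uniform distribution on $[k]$, $d_{TV}$ total variation distance. For a family $\{\mathbf p_z: z\in\mathcal Z\}$ of distributions on $[k]$ and channel $W$, let $\delta_z^W(y)=(\mathbf p_z^W(y)-\mathbf u^W(y))/\mathbf u^W(y)$ and $\langle\delta^W_z,\delta^W_{z'}\rangle=\sum_{y:\mathbf u^W(y)>0}\mathbf u^W(y)\delta_z^W(y)\delta_{z'}^W(y)$. An almost $\epsilon$-perturbation (around $\mathbf u$) is a pair $\mathcal P_\zeta=(\{\mathbf p_z:z\in\mathcal Z\},\zeta)$ with $\zeta$ a distribution on $\mathcal Z$ such that $\Pr_{Z\sim\zeta}[d_{TV}(\mathbf p_Z,\mathbf u)\ge\epsilon]\ge1/10$; let $\Upsilon_\epsilon$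 be the set of these. For $W^n=(W_1,\dots,W_n)$, $\chi^{(2)}(W^n\mid\mathcal P_\zeta)=\log\mathbb E_{Z,Z'}\exp\big(\sum_{i=1}^n\langle\delta_Z^{W_i},\delta_{Z'}^{W_i}\rangle\big)$ with $Z,Z'$ i.i.d. $\sim\zeta$. The maxmin decoupled chi-square fluctuation is $\underline{\chi}^{(2)}(\mathcal W^n,\epsilon)=\sup_{W^n\in\mathcal W^n}\inf_{\mathcal P_\zeta\in\Upsilon_\epsilon}\chi^{(2)}(W^n\mid\mathcal P_\zeta)$. $H(W)$ is the $(k/2)\times(k/2)$ matrix with entries $H(W)_{i_1,i_2}=\sum_{y}\frac{(W(y\mid 2i_1-1)-W(y\mid 2i_1))(W(y\mid 2i_2-1)-W(y\mid 2i_2))}{\sum_{x\in[k]}W(y\mid x)}$ (zero-denominator terms omitted); $\|\cdot\|_*$ is the nuclear norm (sum of singular values).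
   Formalization: The claim is proved for ε at most some universal constant ε0 in (0,1), not for all ε in (0,1): for k = 2 and ε = 3/4 no distribution is ε-far from uniform, so the infimum is over an empty set and the bound fails. *)

(* Defs.v *)
From HB Require Import structures.
From mathcomp Require Import all_boot all_order all_algebra.
From mathcomp Require Import all_classical all_reals all_analysis.

Set Implicit Arguments.
Unset Strict Implicit.
Unset Printing Implicit Defensive.

Import Order.TTheory GRing.Theory Num.Theory.
Local Open Scope classical_set_scope.
Local Open Scope ring_scope.

Section Channels.
Context {R : realType}.

Definition is_dist (T : finType) (p : T -> R) : Prop :=
  (forall x, 0 <= p x) /\ \sum_x p x = 1.

(* The alphabet [k] is 'I_k, indexed from 0; W x y stands for W(y | x). *)
Definition is_channel (k : nat) (Y : finType) (W : 'I_k -> Y -> R) : Prop :=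
  forall x, is_dist (W x).

Definition output (k : nat) (Y : finType) (p : 'I_k -> R) (W : 'I_k -> Y -> R)
  (y : Y) : R := \sum_x p x * W x y.

Definition unif (k : nat) : 'I_k -> R := fun=> k%:R^-1.

Definition dTV (T : finType) (p q : T -> R) : R :=
  2^-1 * \sum_x `|p x - q x|.

Definition delta (k : nat) (Y : finType) (p : 'I_k -> R) (W : 'I_k -> Y -> R)
  (y : Y) : R := (output p W y - output (@unif k) W y) / output (@unif k) W y.

Definition delta_dot (k : nat) (Y : finType) (W : 'I_k -> Y -> R)
  (p q : 'I_k -> R) : R :=
  \sum_(y | 0 < output (@unif k) W y)
     output (@unif k) W y * delta p W y * delta q W y.

(* The index set Z of the family is an arbitrary measurable space;
   measurability of z |-> p_z is what gives a meaning to the probability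
   below and to the expectation in chi2. *)
Definition almost_perturbation (k : nat) (eps : R) d (Z : measurableType d)
    (p : Z -> 'I_k -> R) (zeta : probability Z R) : Prop :=
  [/\ forall z, is_dist (p z),
      forall x, measurable_fun setT (fun z => p z x) &
      ((10^-1)%:E <= zeta [set z | eps <= dTV (p z) (@unif k)]%R)%E].

Definition chi2 (k n : nat) (Y : finType) (W : 'I_n -> 'I_k -> Y -> R)
    d (Z : measurableType d) (p : Z -> 'I_k -> R) (zeta : probability Z R)
    : \bar R :=
  lne (\int[(zeta \x zeta)%E]_zz
    (expR (\sum_(i < n) delta_dot (W i) (p zz.1) (p zz.2)))%:E)%E.

Definition inf_chi2 (k n : nat) (Y : finType) (W : 'I_n -> 'I_k -> Y -> R)
    (eps : R) : \bar R :=
  ereal_inf [set c | exists (d : measure_display) (Z : measurableType d)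
                       (p : Z -> 'I_k -> R) (zeta : probability Z R),
                     almost_perturbation eps p zeta /\ c = chi2 W p zeta].

Definition maxmin_chi2 (k n : nat) (Y : finType)
    (calW : set ('I_k -> Y -> R)) (eps : R) : \bar R :=
  ereal_sup [set inf_chi2 W eps
            | W in [set W : 'I_n -> 'I_k -> Y -> R | forall i, calW (W i)]].

Lemma pair_snd_subproof (k : nat) (i : 'I_(k./2)) : (i.*2.+1 < k)%N.
Proof.
have hi : (i.*2.+2 <= (k./2).*2)%N by rewrite -doubleS leq_double ltn_ord.
by rewrite (leq_trans hi)// -[leqRHS]odd_double_half leq_addl.
Qed.

Definition pair_snd (k : nat) (i : 'I_(k./2)) : 'I_k :=
  Ordinal (pair_snd_subproof i).
Definition pair_fst (k : nat) (i : 'I_(k./2)) : 'I_k :=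
  Ordinal (ltnW (pair_snd_subproof i)).

Definition Hmx (k : nat) (Y : finType) (W : 'I_k -> Y -> R) : 'M[R]_(k./2) :=
  \matrix_(i, j) \sum_(y | \sum_x W x y != 0)
    (W (pair_fst i) y - W (pair_snd i) y) *
    (W (pair_fst j) y - W (pair_snd j) y) / \sum_x W x y.

(* Singular values are the square roots of the eigenvalues of A^T A, summed
   here with multiplicity. *)
Definition nuclear_norm (m n : nat) (A : 'M[R]_(m, n)) : R :=
  let q := char_poly (A^T *m A) in
  \sum_(x \in [set x : R | root q x]) (mup x q)%:R * Num.sqrt x.

(* The family may be infinite, so the maximum of the nuclear norm over it is
   taken to be a supremum. *)
Definition max_nuclear (k : nat) (Y : finType) (calW : set ('I_k -> Y -> R))
    : \bar R :=
  ereal_sup [set (nuclear_norm (Hmx W))%:E | W in calW].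

End Channels.

Arguments maxmin_chi2 {R k} n {Y} calW eps.

(* Main.v *)
(* Write h = k/2, S = \sum_i Hmx (W i), T = \tr S; each Hmx (W i) is symmetric
   positive semidefinite, so T is at most the sum of the nuclear norms.  For
   z in R^h perturb the uniform distribution by +-g z_i / k on the i-th pair of
   symbols, with g = 64 eps.  Then the exponent in chi2 is
   (g^2 / k) z S z'^T, and it remains to find a random z that is bounded,
   has l1-norm of order h, and is sub-Gaussian where S is small.

   Such a z is the end point of a random walk of about h/16 steps in R^h.  A
   step adds +-e_j, where e_1, ..., e_m (m >= h/2) is an orthonormal family
   orthogonal to z, to the coordinates with |z_i| > 1, and to the eigenvectors
   of S of eigenvalue > 16 T / h, and j and the sign are uniform.  After t steps
   |z|^2 = t exactly, hence at most t coordinates are frozen, so there is always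
   room for m directions; moreover |z_i| <= 2, so |z|_1 >= |z|^2 / 2.  By
   Bessel's inequality and cosh x <= 1 + 2 x^2 for small x, each step multiplies
   E exp <w, z> by at most exp (4 |w|^2 / h) when |w| <= 1/2.  Apply this to
   w = (g^2 / k) z S, for which |w|^2 = O(eps^4 T^2 / k^3) because z avoids
   the large eigenvalues; the hypothesis on n is what makes |w| small. *)
From HB Require Import structures.
Require Import Defs.
From mathcomp Require Import all_boot all_order all_algebra.
From mathcomp Require Import all_classical all_reals all_analysis.
From mathcomp Require Import measurable_realfun complex ring lra zify.

Set Implicit Arguments.
Unset Strict Implicit.
Unset Printing Implicit Defensive.

Import Order.TTheory GRing.Theory Num.Theory.
Local Open Scope classical_set_scope.
Local Open Scope ring_scope.

(** * Euclidean geometry of row vectors and the real spectral theorem *)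

Section Euclidean.
Context {R : rcfType}.

Definition dotv n (u v : 'rV[R]_n) : R := (u *m v^T) 0 0.

Lemma dotvE n (u v : 'rV[R]_n) : dotv u v = \sum_i u 0 i * v 0 i.
Proof. by rewrite /dotv mxE; apply: eq_bigr => i _; rewrite mxE. Qed.

Lemma mulmx_tr11 n (u v : 'rV[R]_n) : u *m v^T = (dotv u v)%:M.
Proof. exact: mx11_scalar. Qed.

Lemma dotvC n (u v : 'rV[R]_n) : dotv u v = dotv v u.
Proof. by rewrite !dotvE; apply: eq_bigr => i _; rewrite mulrC. Qed.

Lemma dotvDl n (u v w : 'rV[R]_n) : dotv (u + v) w = dotv u w + dotv v w.
Proof. by rewrite /dotv mulmxDl mxE. Qed.

Lemma dotvDr n (u v w : 'rV[R]_n) : dotv w (u + v) = dotv w u + dotv w v.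
Proof. by rewrite dotvC dotvDl !(dotvC w). Qed.

Lemma dotvZl n a (u v : 'rV[R]_n) : dotv (a *: u) v = a * dotv u v.
Proof. by rewrite /dotv -scalemxAl mxE. Qed.

Lemma dotvZr n a (u v : 'rV[R]_n) : dotv u (a *: v) = a * dotv u v.
Proof. by rewrite dotvC dotvZl dotvC. Qed.

Lemma dotvNl n (u v : 'rV[R]_n) : dotv (- u) v = - dotv u v.
Proof. by rewrite -scaleN1r dotvZl mulN1r. Qed.

Lemma dotvNr n (u v : 'rV[R]_n) : dotv u (- v) = - dotv u v.
Proof. by rewrite dotvC dotvNl dotvC. Qed.

Lemma dotv_ge0 n (u : 'rV[R]_n) : 0 <= dotv u u.
Proof. by rewrite dotvE sumr_ge0// => i _; rewrite -expr2 sqr_ge0. Qed.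

Lemma dotv_eq0 n (u : 'rV[R]_n) : (dotv u u == 0) = (u == 0).
Proof.
apply/eqP/eqP => [|->]; last by rewrite /dotv mul0mx mxE.
rewrite dotvE => /eqP; rewrite psumr_eq0 => [/allP u0|i _]; last first.
  by rewrite -expr2 sqr_ge0.
apply/rowP => i; rewrite mxE; apply/eqP.
by have := u0 i (mem_index_enum _); rewrite mulf_eq0 orbb.
Qed.

Lemma sqr_coord_le_dotv n (u : 'rV[R]_n) i : u 0 i ^+ 2 <= dotv u u.
Proof.
rewrite dotvE (bigD1 i)//= -expr2 lerDl sumr_ge0// => j _.
by rewrite -expr2 sqr_ge0.
Qed.

Lemma kernel_unit_vector p n (C : 'M[R]_(p, n)) : (\rank C < n)%N ->
  exists2 x : 'rV[R]_n, dotv x x = 1 & x *m C^T = 0.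
Proof.
move=> rC; have : kermx C^T != 0.
  by rewrite -mxrank_eq0 mxrank_ker mxrank_tr -lt0n subn_gt0.
case/rowV0Pn => v /sub_kermxP vC v0.
have vv0 : 0 < dotv v v by rewrite lt_def dotv_ge0 dotv_eq0 v0.
exists ((Num.sqrt (dotv v v))^-1 *: v); last by rewrite -scalemxAl vC scaler0.
rewrite dotvZl dotvZr mulrA -invfM -expr2 sqr_sqrtr ?ltW//.
by rewrite mulVf ?gt_eqF.
Qed.

(** Unit vectors are added one at a time, each in the kernel of [C] stacked with the rows already
    found; the rank hypothesis keeps that kernel nonzero. *)
Lemma kernel_orthonormal p n m (C : 'M[R]_(p, n)) : (\rank C + m <= n)%N ->
  exists2 E : 'M[R]_(m, n), E *m E^T = 1%:M & E *m C^T = 0.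
Proof.
elim: m => [|m IH] rC; first by exists 0; apply/matrixP => -[].
have [|E EE EC] := IH; first by lia.
have [|x xx xCE] := @kernel_unit_vector _ _ (col_mx C E).
  rewrite -addsmxE (leq_ltn_trans (mxrank_adds_leqif _ _))//.
  by rewrite (@leq_ltn_trans (\rank C + m))// ?leq_add2l ?rank_leq_row; lia.
move: xCE; rewrite tr_col_mx mul_mx_row -[RHS]row_mx0 => /eq_row_mx[xC xE].
have Ex : E *m x^T = 0 by apply: trmx_inj; rewrite trmx_mul trmxK xE trmx0.
have QQ : col_mx x E *m (col_mx x E)^T = 1%:M.
  by rewrite tr_col_mx mul_col_row EE xE Ex mulmx_tr11 xx -scalar_mx_block.
have QC : col_mx x E *m C^T = 0 by rewrite mul_col_mx xC EC col_mx0.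
by exists (col_mx x E).
Qed.

(** Expand [|w - w E^T E|^2 >= 0]: both cross products and the square of the projection [w E^T E]
    equal [|w E^T|^2]. *)
Lemma bessel m n (E : 'M[R]_(m, n)) (w : 'rV[R]_n) : E *m E^T = 1%:M ->
  \sum_j dotv w (row j E) ^+ 2 <= dotv w w.
Proof.
move=> EE; have -> : \sum_j dotv w (row j E) ^+ 2 = dotv (w *m E^T) (w *m E^T).
  rewrite [RHS]dotvE; apply: eq_bigr => j _; rewrite expr2.
  suff -> : dotv w (row j E) = (w *m E^T) 0 j by [].
  by rewrite dotvE mxE; apply: eq_bigr => i _; rewrite !mxE.
have := dotv_ge0 (w - w *m E^T *m E).
rewrite dotvDl !dotvDr !dotvNl !dotvNr.
have -> : dotv w (w *m E^T *m E) = dotv (w *m E^T) (w *m E^T).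
  by rewrite /dotv !trmx_mul trmxK !mulmxA.
have -> : dotv (w *m E^T *m E) w = dotv (w *m E^T) (w *m E^T).
  by rewrite /dotv !trmx_mul trmxK !mulmxA.
have -> : dotv (w *m E^T *m E) (w *m E^T *m E) = dotv (w *m E^T) (w *m E^T).
  rewrite /dotv !trmx_mul trmxK !mulmxA -2!(mulmxA _ E) EE mulmx1.
  by rewrite -!mulmxA.
lra.
Qed.

Lemma mxrank_diag_indicator n (P : pred 'I_n) :
  (\rank (diag_mx (\row_i (P i)%:R : 'rV[R]_n)) <= #|P|)%N.
Proof.
have -> : diag_mx (\row_i (P i)%:R : 'rV[R]_n) =
    \sum_(i | P i) delta_mx i i.
  apply/matrixP => i j; rewrite !mxE summxE; case: eqVneq => [->|ij].
    rewrite mulr1n; case: (boolP (P j)) => Pj.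
      rewrite (bigD1 j)//= big1 ?addr0 ?mxE ?eqxx// => l /andP[_ lj].
      by rewrite mxE eq_sym (negbTE lj).
    rewrite big1// => l Pl; rewrite mxE; case: eqVneq => //= jl.
    by rewrite jl Pl in Pj.
  rewrite mulr0n big1// => l _; rewrite mxE; case: eqVneq => //= il.
  by rewrite -il eq_sym (negbTE ij).
rewrite -sum1_card.
elim/big_ind2: _ => [|A a B b Aa Bb|i _]; rewrite ?mxrank0 ?mxrank_delta//.
exact: (leq_trans (mxrank_add _ _) (leq_add Aa Bb)).
Qed.

(** Over [R[i]] the matrix is Hermitian, so its spectral decomposition provides a real eigenvalue
    [a]. The characteristic polynomial has coefficients in [R], so [a] is a root of it there and has
    an eigenvector over [R]. *)
Lemma symmetric_eigenvector n (A : 'M[R]_n.+1) : A^T = A ->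
  exists a (x : 'rV[R]_n.+1), dotv x x = 1 /\ x *m A = a *: x.
Proof.
move=> As; pose Ac := map_mx (real_complex R) A.
have Ah : Ac \is hermsymmx.
  apply: realsym_hermsym.
    apply/is_hermitianmxP; rewrite expr0 scale1r; apply/matrixP => i j.
    by rewrite !mxE -[in LHS]As mxE.
  by apply/mxOverP => i j; rewrite mxE; apply/complex_realP; exists (A i j).
have /hermitian_normalmx/orthomx_spectralP := Ah.
have /mxOverP/(_ 0 0) := hermitian_spectral_diag_real Ah.
set P := spectralmx Ac; set D := spectral_diag Ac.
move=> /complex_realP[a Da] AP.
have : eigenvalue Ac (a%:C)%C.
  apply/eigenvalueP; exists (row 0 P).
    rewrite rowE -mulmxA {1}AP !mulmxA mulmxK ?spectral_unit//.
    rewrite -(rowE _ (diag_mx _)) row_diag_mx.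
    by rewrite -Da -scalemxAl.
  rewrite -mxrank_eq0 rowE mxrankMfree ?mxrank_delta//.
  by rewrite row_free_unit spectral_unit.
rewrite eigenvalue_root_char -map_char_poly fmorph_root -eigenvalue_root_char.
case/eigenvalueP => v vA v0.
have vv0 : 0 < dotv v v by rewrite lt_def dotv_ge0 dotv_eq0 v0.
exists a, ((Num.sqrt (dotv v v))^-1 *: v); split.
  rewrite dotvZl dotvZr mulrA -invfM -expr2 sqr_sqrtr ?ltW//.
  by rewrite mulVf ?gt_eqF.
by rewrite -scalemxAl vA !scalerA mulrC.
Qed.

(** Deflation: split off a unit eigenvector [x] and diagonalise by induction the compression of [A]
    to the orthogonal complement of [x]. *)
Theorem real_spectral n (A : 'M[R]_n) : A^T = A ->
  exists (U : 'M[R]_n) (d : 'rV[R]_n),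
    U *m U^T = 1%:M /\ A = U^T *m diag_mx d *m U.
Proof.
elim: n A => [|n IH] A As.
  by exists 0, 0; split; apply/matrixP => -[].
have [a [x [xx xA]]] := symmetric_eigenvector As.
have [|E EE Ex] := @kernel_orthonormal _ _ n x.
  by rewrite rank_rV; case: eqP => /= _; lia.
have [|U [d [UU Ad]]] := IH (E *m A *m E^T).
  by rewrite !trmx_mul trmxK As mulmxA.
pose Q : 'M[R]_(1 + n) := col_mx x E.
have xE : x *m E^T = 0 by apply: trmx_inj; rewrite trmx_mul trmxK Ex trmx0.
have QQ : Q *m Q^T = 1%:M.
  by rewrite tr_col_mx mul_col_row EE xE Ex mulmx_tr11 xx -scalar_mx_block.
have QAQ : Q *m A *m Q^T = block_mx a%:M 0 0 (E *m A *m E^T).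
  rewrite tr_col_mx mul_col_mx mul_col_row xA -!scalemxAl xE scaler0.
  rewrite mulmx_tr11 xx.
  have -> : E *m A *m x^T = 0.
    apply: trmx_inj; rewrite !trmx_mul trmxK As mulmxA xA -scalemxAl xE.
    by rewrite scaler0 trmx0.
  by rewrite scale_scalar_mx mulr1.
pose B : 'M[R]_(1 + n) := block_mx 1%:M 0 0 U.
pose D : 'rV[R]_(1 + n) := row_mx a%:M d.
have BB : B *m B^T = 1%:M.
  rewrite tr_block_mx mulmx_block !trmx0 trmx1 !(mulmx0, mul0mx) UU mul1mx.
  by rewrite !addr0 add0r -scalar_mx_block.
have DB : B^T *m diag_mx D *m B = block_mx a%:M 0 0 (U^T *m diag_mx d *m U).
  rewrite tr_block_mx !trmx0 trmx1 diag_mx_row !mulmx_block.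
  rewrite !(mulmx0, mul0mx, mulmx1, mul1mx, addr0, add0r).
  by congr block_mx; apply/matrixP => i j; rewrite !mxE !ord1 !eqxx.
exists (B *m Q), D; split.
  by rewrite trmx_mul -!mulmxA (mulmxA Q) QQ mul1mx BB.
have QTQ : Q^T *m Q = 1%:M by apply: mulmx1C.
have -> : A = Q^T *m (Q *m A *m Q^T) *m Q.
  by rewrite !mulmxA QTQ mul1mx -mulmxA QTQ mulmx1.
rewrite QAQ Ad trmx_mul -3!(mulmxA Q^T); congr (_ *m _); rewrite !mulmxA.
by rewrite -DB.
Qed.

End Euclidean.

(** * Nuclear norm and small eigenspaces *)

Lemma char_poly_conj (F : comNzRingType) n (U A : 'M[F]_n) : U *m U^T = 1%:M ->
  char_poly (U^T *m A *m U) = char_poly A.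
Proof.
move=> UU; have UU' := mulmx1C UU.
rewrite /char_poly /char_poly_mx.
have -> : 'X%:M - map_mx polyC (U^T *m A *m U) =
    map_mx polyC U^T *m ('X%:M - map_mx polyC A) *m map_mx polyC U.
  rewrite mulmxBr mulmxBl !map_mxM; congr (_ - _).
  by rewrite mul_mx_scalar -scalemxAl -map_mxM UU' map_mx1 scalemx1.
rewrite !det_mulmx mulrAC -det_mulmx -map_mxM UU' map_mx1 det1.
by rewrite mul1r.
Qed.

Lemma mup_prod_XsubC (F : fieldType) (I : Type) (r : seq I) (a : I -> F) x :
  mup x (\prod_(i <- r) ('X - (a i)%:P)) = count (fun i => a i == x) r.
Proof.
elim: r => [|i r IH]; first by rewrite big_nil mupNroot// root1.
rewrite big_cons mupM ?polyXsubC_eq0 ?monic_neq0 ?monic_prod_XsubC//=.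
by rewrite IH -['X - _]expr1 mup_XsubCX eq_sym; case: eqVneq.
Qed.

Section Nuclear.
Context {R : realType}.

Lemma nuclear_norm_spectral n (A U : 'M[R]_n) (d : 'rV[R]_n) :
  U *m U^T = 1%:M -> A = U^T *m diag_mx d *m U ->
  nuclear_norm A = \sum_i `|d 0 i|.
Proof.
move=> UU ->; rewrite /nuclear_norm.
have -> : (U^T *m diag_mx d *m U)^T *m (U^T *m diag_mx d *m U) =
    U^T *m diag_mx (\row_i (d 0 i ^+ 2)) *m U.
  rewrite !trmx_mul trmxK tr_diag_mx !mulmxA -(mulmxA _ U) UU mulmx1.
  by rewrite -(mulmxA U^T (diag_mx d)) mulmx_diag; congr (_ *m diag_mx _ *m _).
have -> : char_poly (U^T *m diag_mx (\row_i (d 0 i ^+ 2)) *m U) =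
    \prod_(i < n) ('X - (d 0 i ^+ 2)%:P).
  rewrite char_poly_conj// char_poly_trig ?diag_mx_is_trig//.
  by apply: eq_bigr => i _; rewrite !mxE eqxx.
set q := \prod_(i < n) _.
have rq x : root q x = (x \in [seq d 0 i ^+ 2 | i <- index_enum 'I_n]).
  rewrite /q -(big_map (fun i => d 0 i ^+ 2) xpredT (fun a => 'X - a%:P)).
  exact: root_prod_XsubC.
have -> : [set x | root q x] =
    [set` undup [seq d 0 i ^+ 2 | i <- index_enum 'I_n]].
  by apply/seteqP; split=> x /=; rewrite mem_undup rq.
rewrite -fsbig_seq ?undup_uniq//.
under eq_bigr do rewrite /q mup_prod_XsubC.
transitivity (\sum_(i < n) Num.sqrt (d 0 i ^+ 2)); last first.
  by apply: eq_bigr => i _; rewrite sqrtr_sqr.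
(* The nuclear norm runs over distinct roots weighted by multiplicity; grouping the indices [i] by
   the value of [d 0 i ^+ 2] recovers this sum. *)
rewrite [RHS](eq_big_seq (fun i =>
  \sum_(x <- undup [seq d 0 i ^+ 2 | i <- index_enum 'I_n] | d 0 i ^+ 2 == x)
    Num.sqrt x)); last first.
  move=> i iI; rewrite -big_filter.
  rewrite (eq_filter (a2 := pred1 (d 0 i ^+ 2))) => [|x]; last first.
    by rewrite /= eq_sym.
  rewrite filter_pred1_uniq ?undup_uniq ?mem_undup ?big_seq1//.
  exact: (map_f (fun i => d 0 i ^+ 2)).
rewrite (exchange_big_dep xpredT)//=; apply: eq_bigr => x _.
by rewrite big_const_seq iter_addr addr0 -[RHS]mulr_natl.
Qed.

Lemma mxtrace_le_nuclear_norm n (A : 'M[R]_n) :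
  A^T = A -> \tr A <= nuclear_norm A.
Proof.
move=> /real_spectral[U [d [UU AE]]]; rewrite (nuclear_norm_spectral UU AE) AE.
rewrite mxtrace_mulC mulmxA UU mul1mx mxtrace_diag ler_sum// => i _.
exact: ler_norm.
Qed.

(** Markov's inequality on the spectrum: the eigenvalues are nonnegative with sum [\tr A], so at
    most [n / 16] of them exceed [16 * \tr A / n]. The nonzero rows of [C] are the corresponding
    eigenvectors. *)
Lemma small_eigenspace n (A : 'M[R]_n) : A^T = A ->
  (forall z, 0 <= dotv z (z *m A)) ->
  exists2 C : 'M[R]_n, (16 * \rank C <= n)%N &
    forall z : 'rV[R]_n, z *m C^T = 0 ->
      dotv (z *m A) (z *m A) <= (16 * \tr A / n%:R) ^+ 2 * dotv z z.
Proof.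
move=> /real_spectral[U [d [UU AE]]] A0; have UU' := mulmx1C UU.
have trA : \tr A = \sum_i d 0 i.
  by rewrite AE mxtrace_mulC mulmxA UU mul1mx mxtrace_diag.
have d0 i : 0 <= d 0 i.
  have := A0 (row i U); rewrite AE !mulmxA rowE -!(mulmxA _ U) UU mulmx1.
  rewrite -(rowE _ (diag_mx _)) row_diag_mx -scalemxAl dotvZr.
  suff -> : dotv (delta_mx 0 i *m U) (delta_mx 0 i *m U) = 1 by rewrite mulr1.
  rewrite /dotv trmx_mul mulmxA -(mulmxA _ U) UU mulmx1 trmx_delta mul_delta_mx.
  by rewrite mxE !eqxx.
set thr := 16 * _ / _.
have tr0 : 0 <= \tr A by rewrite trA sumr_ge0.
pose bad := [pred i | thr < d 0 i].
exists (diag_mx (\row_i (bad i)%:R) *m U).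
  apply: (@leq_trans (16 * #|bad|)).
    rewrite leq_mul2l /= (leq_trans (mxrankM_maxl _ _))//.
    exact: mxrank_diag_indicator.
  case: (posnP #|bad|) => [->|bad_gt0]; first by rewrite muln0.
  have [i0 i0b] : exists i, i \in bad by apply/card_gt0P.
  have n0 : (0 < n)%N by case: (n) i0 {i0b}; [case|].
  have lt_thr : thr * #|bad|%:R < \tr A.
    rewrite trA (bigID (mem bad))/= ltr_wpDr ?sumr_ge0//.
    rewrite -sumr_const mulr_sumr.
    rewrite (bigD1 i0)//= [ltRHS](bigD1 i0)//= ltr_leD ?mulr1//.
    by apply: ler_sum => i /andP[/ltW ? _]; rewrite ?mulr1.
  have T0 : 0 < \tr A.
    rewrite lt_def tr0 andbT; apply/eqP => T0; move: lt_thr.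
    by rewrite /thr T0 mulr0 !mul0r ltxx.
  rewrite -(ler_nat R) natrM ltW// -(ltr_pM2l T0).
  have nR : (0 : R) < n%:R by rewrite ltr0n.
  have <- : thr * #|bad|%:R * n%:R = \tr A * (16 * #|bad|%:R).
    by rewrite /thr; field; rewrite gt_eqF.
  by rewrite ltr_pM2r.
move=> z; rewrite trmx_mul tr_diag_mx mulmxA => zC.
have zz : dotv z z = dotv (z *m U^T) (z *m U^T).
  by rewrite /dotv trmx_mul trmxK mulmxA -(mulmxA z) UU' mulmx1.
have -> : dotv (z *m A) (z *m A) =
    dotv (z *m U^T *m diag_mx d) (z *m U^T *m diag_mx d).
  rewrite AE !mulmxA {1}/dotv trmx_mul mulmxA -(mulmxA _ U) UU mulmx1.
  by rewrite /dotv.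
rewrite zz !dotvE mulr_sumr; apply: ler_sum => i _.
have := congr1 (fun M : 'rV[R]_n => M 0 i) zC.
rewrite /= !mul_mx_diag !mxE; set y := \sum_j _.
case: (boolP (thr < d 0 i)) => [_|].
  by rewrite mulr1 => ->; rewrite !(mul0r, mulr0).
rewrite -leNgt => di _.
rewrite mulrACA -expr2 mulrC ler_wpM2r ?sqr_ge0//.
by rewrite -expr2 ler_pXn2r// nnegrE (le_trans (d0 i)).
Qed.

End Nuclear.

(** * The random walk *)

Section Walk.
Context {R : realType}.

Lemma expR_le_inv (x : R) : x < 1 -> expR x <= (1 - x)^-1.
Proof.
move=> x1; rewrite -[expR x]invrK -expRN lef_pV2 ?posrE ?expR_gt0 ?subr_gt0//.
exact: expR_ge1Dx.
Qed.

(** Applying [exp x <= 1 / (1 - x)] to both signs gives the bound [2 / (1 - x^2)]. *)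
Lemma expR_addN_le (x : R) :
  x ^+ 2 <= 4^-1 -> expR x + expR (- x) <= 2 + 4 * x ^+ 2.
Proof.
move=> x2; have [x1 x1'] : x < 1 /\ - x < 1 by split; nra.
apply: (le_trans (lerD (expR_le_inv x1) (expR_le_inv x1'))).
have -> : (1 - x)^-1 + (1 - - x)^-1 = 2 / (1 - x ^+ 2) by field; nra.
by rewrite ler_pdivrMr; nra.
Qed.

(** The invariant after [t] steps; [C] carries the eigenvectors to avoid. The norm is exact because
    each step is a unit vector orthogonal to the current point. The bound 2 is the freezing
    threshold 1 plus one step. *)
Definition walk_point n (C : 'M[R]_n) (t : nat) (z : 'rV[R]_n) : Prop :=
  [/\ z *m C^T = 0, dotv z z = t%:R & forall i, `|z 0 i| <= 2].

Lemma walk_directions n (C : 'M[R]_n) t z :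
  (16 * \rank C <= n)%N -> (16 * t < n)%N -> walk_point C t z ->
  exists E : 'M[R]_(uphalf n, n), [/\ E *m E^T = 1%:M, E *m C^T = 0,
    forall j, dotv z (row j E) = 0 &
    forall i j, 1 < `|z 0 i| -> E j i = 0].
Proof.
move=> rC tn [zC zz zi].
pose dead := [pred i | 1 < `|z 0 i|].
have dead_le : (#|dead| <= t)%N.
  rewrite -(ler_nat R) -zz dotvE (bigID (mem dead))/= ler_wpDr//.
    by rewrite sumr_ge0// => i _; rewrite -expr2 sqr_ge0.
  rewrite -sumr_const; apply: ler_sum => i; rewrite inE => /ltW di.
  by rewrite -expr2 -real_normK ?num_real// expr_ge1.
pose M := col_mx C (col_mx z (diag_mx (\row_i (dead i)%:R))).
have rM : (\rank M + uphalf n <= n)%N.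
  have rk : (\rank M <= \rank C + (z != 0%R) + t)%N.
    rewrite /M -addsmxE (leq_trans (mxrank_adds_leqif _ _))// -addnA leq_add2l.
    rewrite -addsmxE (leq_trans (mxrank_adds_leqif _ _))// rank_rV leq_add2l.
    exact: leq_trans (mxrank_diag_indicator _) dead_le.
  suff : (\rank C + (z != 0%R) + t + uphalf n <= n)%N by lia.
  (* At [t = 0] the point is zero and imposes no constraint; counting one would leave no room when
     [n = 1]. *)
  rewrite -dotv_eq0 zz pnatr_eq0; case: eqP => /= t0; lia.
have [E EE EM] := kernel_orthonormal rM.
move: EM; rewrite !tr_col_mx !mul_mx_row -[RHS]row_mx0 => /eq_row_mx[EC].
rewrite -[RHS]row_mx0 => /eq_row_mx[Ez Ed].
exists E; split=> // [j|i j zi1].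
  by rewrite dotvC /dotv -row_mul Ez !mxE.
move: Ed; rewrite tr_diag_mx mul_mx_diag => /matrixP/(_ j i).
by rewrite !mxE /= zi1 mulr1.
Qed.

(** A list encodes the uniform law on its entries. Its size does not depend on [z], so concatenating
    the successor lists of equally likely points gives the law after one more step. *)
Lemma walk_step n (C : 'M[R]_n) t z :
  (16 * \rank C <= n)%N -> (16 * t < n)%N -> walk_point C t z ->
  exists L : seq 'rV[R]_n, [/\ size L = (uphalf n).*2,
    {in L, forall z', walk_point C t.+1 z'} &
    forall w, dotv w w <= 4^-1 -> \sum_(z' <- L) expR (dotv w z') <=
      (size L)%:R * (expR (4 * dotv w w / n%:R) * expR (dotv w z))].
Proof.
move=> rC tn Pz; have [E [EE EC Ez Edead]] := walk_directions rC tn Pz.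
have [zC zz zi] := Pz.
have E1 j : dotv (row j E) (row j E) = 1.
  transitivity ((E *m E^T) j j); last by rewrite EE mxE eqxx.
  by rewrite dotvE mxE; apply: eq_bigr => i _; rewrite !mxE.
have Ele i j : `|E j i| <= 1.
  rewrite -(@expr_le1 _ 2)// real_normK ?num_real//.
  by have := sqr_coord_le_dotv (row j E) i; rewrite E1 mxE.
have step b j : `|b| = 1 -> walk_point C t.+1 (z + b *: row j E).
  move=> b1; split.
  - by rewrite mulmxDl zC add0r -scalemxAl -row_mul EC row0 scaler0.
  - rewrite dotvDl !dotvDr !dotvZl !dotvZr (dotvC _ z) Ez E1 zz !mulr0 !addr0.
    by rewrite add0r mulr1 -expr2 -real_normK ?num_real// b1 expr1n -natr1.
  - move=> i; rewrite !mxE; case: (ltP 1 `|z 0 i|) => [zi1|zi1].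
      by rewrite Edead// mulr0 addr0.
    rewrite (le_trans (ler_normD _ _))// normrM b1 mul1r.
    by rewrite (_ : 2 = 1 + 1)// lerD.
pose L := [seq z + row j E | j <- index_enum 'I_(uphalf n)] ++
          [seq z - row j E | j <- index_enum 'I_(uphalf n)].
have szL : size L = (uphalf n).*2.
  by rewrite size_cat !size_map -[size _]sum1_size sum1_card card_ord addnn.
exists L; split => // [z'|w w4].
  rewrite mem_cat => /orP[]/mapP[j _ ->].
    by rewrite -[row j E]scale1r; apply: step; rewrite normr1.
  by rewrite -scaleN1r; apply: step; rewrite normrN1.
rewrite szL /L big_cat /= !big_map -big_split /=.
(* The two signs along a direction combine into a hyperbolic cosine; Bessel's inequality makes each
   [dotv w (row j E)] small enough to bound it. *)
apply: (@le_trans _ _ (\sum_(j < uphalf n)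
    expR (dotv w z) * (2 + 4 * dotv w (row j E) ^+ 2))).
  apply: ler_sum => j _; rewrite !dotvDr dotvNr !expRD -mulrDr.
  rewrite ler_pM2l ?expR_gt0//; apply: expR_addN_le.
  apply: le_trans w4; apply: le_trans (bessel w EE).
  by rewrite (bigD1 j)//= lerDl sumr_ge0// => l _; rewrite sqr_ge0.
rewrite -mulr_sumr mulrA mulrC ler_pM2r ?expR_gt0//.
rewrite big_split/= sumr_const card_ord -mulr_sumr.
have n0 : (0 : R) < n%:R by rewrite ltr0n; lia.
have hn : n%:R <= (uphalf n).*2%:R :> R by rewrite ler_nat; lia.
(* With [m = uphalf n], Bessel bounds the sum by [2m + 4 |w|^2], and [2m >= n]. *)
apply: (@le_trans _ _ ((uphalf n).*2%:R * (1 + 4 * dotv w w / n%:R))); last first.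
  by rewrite ler_wpM2l// expR_ge1Dx.
have -> : 2 *+ uphalf n = (uphalf n).*2%:R :> R.
  by rewrite -mulr_natr -muln2 mulnC natrM.
rewrite mulrDr mulr1 lerD2l mulrA ler_pdivlMr// mulrAC.
have := bessel w EE; have := dotv_ge0 w.
set s := \sum_(i < _) _ => w0 sw.
have s0 : 0 <= s by rewrite sumr_ge0// => l _; rewrite sqr_ge0.
nra.
Qed.

(** The bound on [t] is what [walk_step] requires of the last step, which starts at time [t - 1]. *)
Lemma walk_exists n (C : 'M[R]_n) t :
  (16 * \rank C <= n)%N -> (16 * t < n + 16)%N ->
  exists L : seq 'rV[R]_n, [/\ L != [::],
    {in L, forall z, walk_point C t z} &
    forall w, dotv w w <= 4^-1 -> \sum_(z <- L) expR (dotv w z) <=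
      (size L)%:R * expR (4 * dotv w w / n%:R * t%:R)].
Proof.
move=> rC; elim: t => [_|t IH tn].
  exists [:: 0]; split => // [z|w _].
    rewrite inE => /eqP ->; split; first by rewrite mul0mx.
      by rewrite /dotv mul0mx mxE.
    by move=> i; rewrite mxE normr0.
  by rewrite big_seq1 /dotv trmx0 !mulmx0 mxE mulr0 expR0 mulr1.
have [|L [L0 LP Lw]] := IH; first lia.
have tn' : (16 * t < n)%N by lia.
have stepE z : exists L', walk_point C t z -> [/\ size L' = (uphalf n).*2,
    {in L', forall z', walk_point C t.+1 z'} &
    forall w, dotv w w <= 4^-1 -> \sum_(z' <- L') expR (dotv w z') <=
      (size L')%:R * (expR (4 * dotv w w / n%:R) * expR (dotv w z))].
  have [Pz|nPz] := pselect (walk_point C t z); last by exists [::].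
  by have [L' ?] := walk_step rC tn' Pz; exists L'.
have [F FP] := choice stepE.
have sz : size (flatten (map F L)) = (size L * (uphalf n).*2)%N.
  rewrite size_flatten /shape -map_comp sumnE big_map.
  rewrite (eq_big_seq (fun=> (uphalf n).*2)) => [|z zL].
    by rewrite big_const_seq count_predT iter_addn_0 mulnC.
  by have [] := FP z (LP z zL).
exists (flatten (map F L)); split.
- by rewrite -size_eq0 sz muln_eq0 negb_or size_eq0 L0 /=; lia.
- move=> z' /flattenP[_ /mapP[z zL ->] z'F].
  by have [_ /(_ z' z'F)] := FP z (LP z zL).
- move=> w w4; rewrite sz big_flatten big_map natrM mulrAC.
  apply: (@le_trans _ _ (\sum_(z <- L) (uphalf n).*2%:R *
      (expR (4 * dotv w w / n%:R) * expR (dotv w z)))).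
    rewrite big_seq [leRHS]big_seq; apply: ler_sum => z zL.
    by have [<- _ /(_ w w4)] := FP z (LP z zL).
  rewrite -!mulr_sumr mulrC ler_wpM2r//.
  set c := 4 * _ / _.
  have -> : c * t.+1%:R = c + c * t%:R by rewrite -natr1; ring.
  by rewrite expRD mulrCA ler_pM2l ?expR_gt0// Lw.
Qed.

End Walk.

(** * Paired perturbations of the uniform distribution *)

Section Perturbation.
Context {R : realType}.

Lemma pair_cases k (x : 'I_k) : ~~ odd k ->
  exists i : 'I_(k./2), x = pair_fst i \/ x = pair_snd i.
Proof.
move=> kE; have xk : (x./2 < k./2)%N by have := ltn_ord x; lia.
exists (Ordinal xk); case: (boolP (odd x)) => ox; [right|left];
  apply: val_inj => /=; lia.
Qed.

Lemma pair_fst_inj k : injective (@pair_fst k).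
Proof. by move=> i j /(congr1 val)/= /double_inj/val_inj. Qed.

Lemma pair_snd_inj k : injective (@pair_snd k).
Proof. by move=> i j /(congr1 val)/= [] /double_inj/val_inj. Qed.

Lemma pair_fst_neq_snd k (i j : 'I_(k./2)) : (pair_fst i == pair_snd j) = false.
Proof. by apply/eqP => /(congr1 val)/=; lia. Qed.

Lemma sum_pairs k (F : 'I_k -> R) : ~~ odd k ->
  \sum_x F x = \sum_(i < k./2) (F (pair_fst i) + F (pair_snd i)).
Proof.
move=> kE; transitivity (\sum_x \sum_(i < k./2)
    (F x * (x == pair_fst i)%:R + F x * (x == pair_snd i)%:R)).
  apply: eq_bigr => x _.
  have [i [->|->]] := pair_cases x kE; rewrite (bigD1 i)//= big1 => [|j ji].
  - by rewrite eqxx pair_fst_neq_snd mulr1 mulr0 !addr0.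
  - rewrite (inj_eq (@pair_fst_inj k)) eq_sym (negbTE ji).
    by rewrite pair_fst_neq_snd !mulr0 addr0.
  - by rewrite eqxx eq_sym pair_fst_neq_snd mulr1 mulr0 add0r addr0.
  - rewrite (inj_eq (@pair_snd_inj k)) [i == j]eq_sym (negbTE ji) eq_sym.
    by rewrite pair_fst_neq_snd !mulr0 addr0.
have sel a : \sum_x F x * (x == a)%:R = F a.
  rewrite (bigD1 a)//= eqxx mulr1 big1 ?addr0// => x /negbTE ->.
  by rewrite mulr0.
by rewrite exchange_big/=; apply: eq_bigr => i _; rewrite big_split/= !sel.
Qed.

(** At most one term of the sum is nonzero: the two symbols of pair [i] get masses [(1 + g z_i) / k]
    and [(1 - g z_i) / k]. *)
Definition perturb k (g : R) (z : 'rV[R]_(k./2)) (x : 'I_k) : R :=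
  k%:R^-1 *
  (1 + g * \sum_i z 0 i * ((x == pair_fst i)%:R - (x == pair_snd i)%:R)).

Lemma perturb_fst k g (z : 'rV[R]_(k./2)) i :
  perturb g z (pair_fst i) = k%:R^-1 * (1 + g * z 0 i).
Proof.
rewrite /perturb (bigD1 i)//= big1 => [|j ji].
  by rewrite eqxx pair_fst_neq_snd subr0 mulr1 addr0.
rewrite (inj_eq (@pair_fst_inj k)) eq_sym (negbTE ji).
by rewrite pair_fst_neq_snd subr0 mulr0.
Qed.

Lemma perturb_snd k g (z : 'rV[R]_(k./2)) i :
  perturb g z (pair_snd i) = k%:R^-1 * (1 - g * z 0 i).
Proof.
rewrite /perturb (bigD1 i)//= big1 => [|j ji].
  by rewrite eqxx eq_sym pair_fst_neq_snd sub0r mulrN1 addr0 mulrN.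
rewrite (inj_eq (@pair_snd_inj k)) [i == j]eq_sym (negbTE ji) eq_sym.
by rewrite pair_fst_neq_snd subr0 mulr0.
Qed.

Lemma perturb_dist k g (z : 'rV[R]_(k./2)) : (0 < k)%N -> ~~ odd k -> 0 <= g ->
  (forall i, g * `|z 0 i| <= 1) -> is_dist (perturb g z).
Proof.
move=> k0 kE g0 gz; have kR : (0 : R) < k%:R by rewrite ltr0n.
split=> [x|].
  have [i xi] := pair_cases x kE.
  have : `|g * z 0 i| <= 1 by rewrite normrM (ger0_norm g0).
  rewrite ler_norml => /andP[gz1 gz2].
  case: xi => ->; rewrite ?perturb_fst ?perturb_snd;
    by rewrite mulr_ge0 ?invr_ge0 ?ler0n//; lra.
rewrite sum_pairs//; under eq_bigr do rewrite perturb_fst perturb_snd -mulrDr.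
rewrite -mulr_sumr (eq_bigr (fun=> 2)) => [|i _]; last by ring.
rewrite sumr_const card_ord -[2 *+ _]mulr_natr -natrM mulnC muln2 halfK.
by rewrite (negbTE kE) subn0 mulVf ?gt_eqF.
Qed.

Lemma dTV_perturb k g (z : 'rV[R]_(k./2)) : ~~ odd k -> 0 <= g ->
  dTV (perturb g z) (@unif R k) = g / k%:R * \sum_i `|z 0 i|.
Proof.
move=> kE g0; rewrite /dTV sum_pairs// !mulr_sumr; apply: eq_bigr => i _.
rewrite perturb_fst perturb_snd /unif.
have kR : (0 : R) <= k%:R^-1 by rewrite invr_ge0 ler0n.
rewrite !mulrDr !mulr1 ![_ + _ - _]addrC !addrA !addNr !add0r mulrN normrN.
rewrite !normrM (ger0_norm kR) (ger0_norm g0).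
by move: (k%:R^-1) => c; field.
Qed.

Lemma output_perturb k (Y : finType) g (z : 'rV[R]_(k./2))
    (W : 'I_k -> Y -> R) y :
  output (perturb g z) W y = k%:R^-1 * (\sum_x W x y +
    g * \sum_i z 0 i * (W (pair_fst i) y - W (pair_snd i) y)).
Proof.
rewrite /output /perturb; under eq_bigr do rewrite -mulrA mulrDl mul1r.
rewrite -mulr_sumr big_split/=; congr (_ * (_ + _)).
under eq_bigr do rewrite -mulrA mulr_suml.
rewrite -mulr_sumr exchange_big/=; congr (_ * _); apply: eq_bigr => i _.
have sel a : \sum_x (x == a)%:R * W x y = W a y.
  rewrite (bigD1 a)//= eqxx mul1r big1 ?addr0// => x /negbTE ->.
  by rewrite mul0r.
rewrite -[in RHS](sel (pair_fst i)) -[in RHS](sel (pair_snd i)) -sumrB.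
rewrite mulr_sumr.
by apply: eq_bigr => x _; rewrite -mulrA mulrBl.
Qed.

(** This form shows positivity when [z' = z], and for general [z'] it is the one met in
    [delta_dot]. *)
Lemma dotv_Hmx k (Y : finType) (W : 'I_k -> Y -> R) (z z' : 'rV[R]_(k./2)) :
  dotv (z *m Hmx W) z' = \sum_(y | \sum_x W x y != 0)
    (\sum_i z 0 i * (W (pair_fst i) y - W (pair_snd i) y)) *
    (\sum_i z' 0 i * (W (pair_fst i) y - W (pair_snd i) y)) / \sum_x W x y.
Proof.
rewrite dotvE; under eq_bigr do rewrite mxE mulr_suml.
under [RHS]eq_bigr do rewrite mulr_suml mulr_suml.
rewrite exchange_big/= [RHS]exchange_big/=; apply: eq_bigr => i _.
under eq_bigr do rewrite mxE mulr_sumr mulr_suml.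
under [RHS]eq_bigr do rewrite mulr_sumr mulr_suml.
rewrite exchange_big/=; apply: eq_bigr => y _; apply: eq_bigr => j _.
ring.
Qed.

Lemma trmx_Hmx k (Y : finType) (W : 'I_k -> Y -> R) : (Hmx W)^T = Hmx W.
Proof.
apply/matrixP => i j; rewrite !mxE; apply: eq_bigr => y _.
by rewrite mulrAC mulrC mulrA.
Qed.

Lemma Hmx_psd k (Y : finType) (W : 'I_k -> Y -> R) (z : 'rV[R]_(k./2)) :
  is_channel W -> 0 <= dotv z (z *m Hmx W).
Proof.
move=> Wch; rewrite dotvC dotv_Hmx sumr_ge0// => y _.
rewrite divr_ge0 -?expr2 ?sqr_ge0// sumr_ge0// => x _.
by have [] := Wch x.
Qed.

(** The uniform part cancels in [delta], leaving a term linear in [g z]; the weight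
    [output unif W y] contributes the factor [1 / k]. *)
Lemma delta_dot_perturb k (Y : finType) (W : 'I_k -> Y -> R) g
    (z z' : 'rV[R]_(k./2)) :
  (0 < k)%N -> is_channel W ->
  delta_dot W (perturb g z) (perturb g z') =
    g ^+ 2 / k%:R * dotv (z *m Hmx W) z'.
Proof.
move=> k0 Wch; have kR : (0 : R) < k%:R by rewrite ltr0n.
have S0 y : 0 <= \sum_x W x y by rewrite sumr_ge0// => x _; have [] := Wch x.
have uE y : output (@unif R k) W y = k%:R^-1 * \sum_x W x y.
  by rewrite /output /unif mulr_sumr.
rewrite /delta_dot dotv_Hmx mulr_sumr; apply: eq_big => y.
  by rewrite uE pmulr_rgt0 ?invr_gt0// lt_def S0 andbT.
rewrite uE pmulr_rgt0 ?invr_gt0// => Sy.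
rewrite /delta !output_perturb uE; field.
by rewrite !gt_eqF.
Qed.

End Perturbation.

(** * Uniform distributions on initial segments of nat *)

Section Unif.
Context {R : realType}.

(* Uniform on the N + 1 points 0, ..., N. *)
Definition unif_nat (N : nat) : set nat -> \bar R :=
  mscale (N.+1%:R^-1)%:nng
    (msum (fun i => \d_i : {measure set nat -> \bar R}) N.+1).

HB.instance Definition _ N := Measure.on (unif_nat N).

Lemma unif_natT N : unif_nat N setT = 1%E.
Proof.
rewrite /unif_nat /mscale/= /msum.
rewrite (eq_bigr (fun=> 1%E)) => [|i _]; last exact: diracT.
by rewrite sumEFin sumr_const card_ord -EFinM mulVf ?pnatr_eq0.
Qed.

HB.instance Definition _ N :=
  Measure_isProbability.Build _ _ _ (unif_nat N) (unif_natT N).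

Lemma integral_unif_nat N (f : nat -> \bar R) : (forall i, 0 <= f i)%E ->
  (\int[unif_nat N]_i f i = N.+1%:R^-1%:E * \sum_(i < N.+1) f i)%E.
Proof.
move=> f0; rewrite /unif_nat ge0_integral_mscale//= ge0_integral_measure_sum//.
congr (_ * _)%E; apply: eq_bigr => i _.
by rewrite integral_dirac// diracT mul1e.
Qed.

(** Take [Z] uniform on [0, ..., N]: the distance event then has probability 1, and a bound on the
    mean over [Z'] for each fixed [Z] bounds the double mean. *)
Lemma inf_chi2_le (k n N : nat) (Y : finType) (W : 'I_n -> 'I_k -> Y -> R)
    (eps B : R) (p : nat -> 'I_k -> R) :
  (forall j, is_dist (p j)) -> (forall j, eps <= dTV (p j) (@unif R k)) ->
  (forall j, \sum_(l < N.+1) expR (\sum_(i < n) delta_dot (W i) (p j) (p l)) <=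
     N.+1%:R * expR B) ->
  (inf_chi2 W eps <= B%:E)%E.
Proof.
move=> pdist pfar pexp.
apply: (@le_trans _ _ (chi2 W p (unif_nat N))).
  apply: ereal_inf_lbound; exists _, nat, p, (unif_nat N); split=> //; split=> //.
  rewrite (_ : [set z | _] = setT); last first.
    by apply/seteqP; split=> // z _; exact: pfar.
  by rewrite probability_setT lee_fin; lra.
rewrite /chi2.
(* The exponent is a finite sum of products of functions of a single index, and every function on
   [nat] is measurable. *)
have mnat (f : nat -> R) : measurable_fun setT f by [].
rewrite fubini_tonelli1//=; last first.
  apply/measurable_EFinP; apply: measurableT_comp => //.
  apply: measurable_sum => i; rewrite /delta_dot -/unif.
  under eq_fun do rewrite -big_filter.
  apply: measurable_sum => y; apply: measurable_funM.
    apply: measurable_funM => //.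
    by apply: (measurableT_comp (mnat (fun j => delta (p j) (W i) y))).
  by apply: (measurableT_comp (mnat (fun j => delta (p j) (W i) y))).
rewrite /fubini_F/=.
rewrite integral_unif_nat; last first.
  by move=> j; apply: integral_ge0 => l _; rewrite lee_fin expR_ge0.
under eq_bigr do (rewrite integral_unif_nat;
  last by move=> l; rewrite lee_fin expR_ge0).
have eB : lne (expR B)%:E = B%:E by rewrite lne_EFin ?expR_gt0// expRK.
under eq_bigr do rewrite sumEFin -EFinM.
rewrite sumEFin -EFinM -eB.
rewrite lee_lne ?in_itv/= ?leey ?lee_fin ?expR_ge0 ?andbT//; last first.
  rewrite mulr_ge0 ?invr_ge0// sumr_ge0// => j _; rewrite mulr_ge0 ?invr_ge0//.
  by rewrite sumr_ge0// => l _; rewrite expR_ge0.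
have N0 : (0 : R) < N.+1%:R by rewrite ltr0n.
rewrite ler_pdivrMl// [leRHS](_ : _ = \sum_(j < N.+1) expR B); last first.
  by rewrite sumr_const card_ord mulr_natl.
by apply: ler_sum => j _; rewrite ler_pdivrMl.
Qed.

End Unif.

(** * The main estimate *)

Section Final.
Context {R : realType}.

Lemma mxtrace_psd_ge0 n (A : 'M[R]_n) :
  (forall z, 0 <= dotv z (z *m A)) -> 0 <= \tr A.
Proof.
move=> A0; rewrite /mxtrace sumr_ge0// => i _.
have := A0 (delta_mx 0 i); rewrite dotvC /dotv trmx_delta -rowE -colE.
by rewrite !mxE.
Qed.

Lemma inf_chi2_bound (k n : nat) (Y : finType)
    (W : 'I_n -> 'I_k -> Y -> R) (eps T : R) :
  (2 <= k)%N -> ~~ odd k -> 0 < eps <= 2^-1 ^+ 7 ->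
  (forall i, is_channel (W i)) ->
  (forall i, nuclear_norm (Hmx (W i)) <= T) ->
  (n%:R * eps ^+ 2 * T) ^+ 2 <= 2^-1 ^+ 36 * k%:R ^+ 3 ->
  (inf_chi2 W eps <=
    (2 ^+ 35 * (n%:R ^+ 2 * eps ^+ 4 / k%:R ^+ 3 * T ^+ 2))%:E)%E.
Proof.
move=> k2 kE /andP[eps0 eps1] Wch WT nT.
(* [t] is [h / 16] rounded up, the longest walk available. Then [|z|_1 >= t / 2 >= h / 32], so the
   distance [g |z|_1 / k] is at least [g / 64 = eps]. *)
set h := k./2; set g := 64 * eps; pose t := ((h + 15) %/ 16)%N.
have h0 : (0 < h)%N by rewrite /h; lia.
have hR : (0 : R) < h%:R by rewrite ltr0n.
have kh : k%:R = 2 * h%:R :> R by rewrite -natrM; congr _%:R; rewrite /h; lia.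
have ht : h%:R <= 16 * t%:R :> R by rewrite -natrM ler_nat /t; lia.
have th : t%:R <= h%:R :> R by rewrite ler_nat /t; lia.
have k0 : (0 < k)%N by rewrite (leq_trans _ k2).
have kR : (0 : R) < k%:R by rewrite ltr0n.
have t16 : (16 * t < h + 16)%N by rewrite /t; lia.
have g0 : 0 <= g by rewrite /g; lra.
(* As [|z_i| <= 2], this keeps the perturbed masses nonnegative; it is where [eps <= 2^-7]
   enters. *)
have g2 : g * 2 <= 1 by rewrite /g; lra.
have [gE gE4] : g / 64 = eps /\ g ^+ 4 = 2 ^+ 24 * eps ^+ 4.
  by rewrite /g; split; [field|ring].
clearbody g t.
pose A := \sum_i Hmx (W i).
have AT : A^T = A by rewrite raddf_sum; apply: eq_bigr => i _; exact: trmx_Hmx.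
have dotA z z' : dotv (z *m A) z' = \sum_i dotv (z *m Hmx (W i)) z'.
  by rewrite /A mulmx_sumr /dotv mulmx_suml summxE.
have A0 z : 0 <= dotv z (z *m A).
  by rewrite dotvC dotA sumr_ge0// => i _; rewrite dotvC Hmx_psd.
have trA0 := mxtrace_psd_ge0 A0.
have trA : \tr A <= n%:R * T.
  rewrite raddf_sum/= mulr_natl -[n in leRHS]card_ord -sumr_const.
  rewrite ler_sum// => i _.
  exact: le_trans (mxtrace_le_nuclear_norm (trmx_Hmx _)) (WT i).
have [V rV HV] := small_eigenspace AT A0.
have [L [L0 LP Lw]] := walk_exists rV t16.
have [N sL] : exists N, size L = N.+1.
  by case: (L) L0 => // a s _; exists (size s).
(* The default value lies in [L], so indices beyond the list also give valid perturbations. *)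
pose z j := nth (head 0 L) L j.
have zL j : z j \in L.
  rewrite /z; have [jL|jL] := ltnP j (size L); first exact: mem_nth.
  by rewrite nth_default//; case: (L) L0 => // a s _; rewrite mem_head.
(* [B0] is [(g^2 / k)^2 (16 n T / h)^2 h] with [g = 64 eps] and [h = k / 2]; it will bound [|w|^2].
   The hypothesis makes it at most [1 / 8], within the range [1 / 4] of the walk estimate. *)
set B0 := 2 ^+ 33 * (n%:R ^+ 2 * eps ^+ 4 / k%:R ^+ 3 * T ^+ 2).
have B04 : B0 <= 4^-1.
  have -> : B0 = 2 ^+ 33 * ((n%:R * eps ^+ 2 * T) ^+ 2 / k%:R ^+ 3).
    by rewrite /B0; field; rewrite gt_eqF.
  have : (n%:R * eps ^+ 2 * T) ^+ 2 / k%:R ^+ 3 <= 2^-1 ^+ 36.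
    by rewrite ler_pdivrMr ?exprn_gt0.
  set q := _ / _; lra.
have -> : 2 ^+ 35 * (n%:R ^+ 2 * eps ^+ 4 / k%:R ^+ 3 * T ^+ 2) = 4 * B0.
  by rewrite /B0; ring.
apply: (@inf_chi2_le _ _ _ N _ _ _ _ (fun j => perturb g (z j))).
- move=> j; have [_ _ z2] := LP _ (zL j).
  apply: perturb_dist => // i.
  by rewrite (le_trans _ g2)// ler_wpM2l.
- move=> j; have [_ zz z2] := LP _ (zL j).
  rewrite dTV_perturb// mulrAC ler_pdivlMr// kh.
  have : t%:R <= 2 * \sum_i `|z j 0 i|.
    rewrite -zz dotvE mulr_sumr ler_sum// => i _.
    by rewrite -expr2 -real_normK ?num_real// expr2 ler_wpM2r.
  rewrite -gE; move: (\sum_i _) => s ts.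
  have -> : g / 64 * (2 * h%:R) = g * (h%:R / 32) by field.
  by rewrite ler_wpM2l//; lra.
- move=> j; have [zV zz z2] := LP _ (zL j).
  pose w := (g ^+ 2 / k%:R) *: (z j *m A).
  have wB : dotv w w <= B0.
    rewrite dotvZl dotvZr mulrA.
    have [u uE] : exists u, u = n%:R * T by eexists.
    rewrite -uE in trA.
    have u0 : 0 <= u := le_trans trA0 trA.
    apply: (@le_trans _ _ (g ^+ 2 / k%:R * (g ^+ 2 / k%:R) *
        ((16 * u / h%:R) ^+ 2 * h%:R))).
      rewrite ler_wpM2l -?expr2 ?sqr_ge0// (le_trans (HV _ zV))// zz.
      rewrite ler_pM ?sqr_ge0 ?ler0n//.
      rewrite ler_pXn2r ?nnegrE ?divr_ge0 ?pmulr_rge0//.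
      by rewrite ler_pM2r ?invr_gt0// ler_pM2l.
    rewrite le_eqVlt; apply/orP; left; apply/eqP.
    rewrite /B0 uE kh; have -> : eps ^+ 4 = g ^+ 4 / 2 ^+ 24 by rewrite gE4; field.
    by field; rewrite gt_eqF.
  (* With the first point fixed, the exponent is linear in the second, so the walk estimate applies
     to [w]. *)
  have -> : \sum_(l < N.+1) expR
        (\sum_i delta_dot (W i) (perturb g (z j)) (perturb g (z l)))
      = \sum_(z' <- L) expR (dotv w z').
    rewrite (big_nth (head 0 L)) sL big_mkord; apply: eq_bigr => l _.
    rewrite dotvZl dotA mulr_sumr; congr expR; apply: eq_bigr => i _.
    by rewrite delta_dot_perturb.
  rewrite -sL (le_trans (Lw _ (le_trans wB B04)))// ler_wpM2l// ler_expR.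
  rewrite mulrAC ler_pdivrMr// -(mulrA 4 (dotv w w)) -(mulrA 4 B0) ler_pM2l//.
  by rewrite ler_pM ?dotv_ge0.
Qed.

End Final.

(* With 0^-1 = +oo in \bar R, the condition on n is void when the maximum of
   the nuclear norms is 0. *)
Theorem theorem4p14 (R : realType) :
  exists eps0 C K : R,
    [/\ 0 < eps0 < 1, 0 < C, 0 < K &
    forall (k n : nat) (eps : R) (Y : finType) (calW : set ('I_k -> Y -> R)),
      (2 <= k)%N -> ~~ odd k -> 0 < eps <= eps0 ->
      calW !=set0 -> (forall W, calW W -> is_channel W) ->
      ((n%:R)%:E <=
         C%:E * ((k%:R `^ (3 / 2))%:E / ((eps ^+ 2)%:E * max_nuclear calW)))%E ->
      (maxmin_chi2 n calW eps <=
         K%:E * ((n%:R ^+ 2 * eps ^+ 4 / k%:R ^+ 3)%:E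
                 * max_nuclear calW ^+ 2))%E].
Proof.
(* The constants are those of [inf_chi2_bound], whose condition on [n] is squared: [2^-18] becomes
   [2^-36]. *)
exists (2^-1 ^+ 7), (2^-1 ^+ 18), (2 ^+ 35); split.
- apply/andP; split; lra.
- lra.
- lra.
move=> k n eps Y calW k2 kE eps01 [W0 W0W] Wch.
have [eps0 _] := andP eps01.
set M := max_nuclear calW => nM.
have MW W : calW W -> ((nuclear_norm (Hmx W))%:E <= M)%E.
  by move=> WW; apply: ereal_sup_ubound; exists W.
have nuc0 W : calW W -> 0 <= nuclear_norm (Hmx W).
  move=> WW; apply: le_trans (mxtrace_le_nuclear_norm (trmx_Hmx _)).
  by apply: mxtrace_psd_ge0 => z; exact: Hmx_psd (Wch _ WW).
have M0 : (0 <= M)%E by apply: le_trans (MW _ W0W); rewrite lee_fin nuc0.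
have kR : (0 : R) < k%:R by rewrite ltr0n; lia.
apply: ge_ereal_sup => _ [W /= WW <-].
(* Only the [n] channels in use matter, so [T] is real even if the supremum [M] is infinite; it is 0
   when [n = 0]. *)
pose T := \big[Num.max/0]_i nuclear_norm (Hmx (W i)).
have T0 : 0 <= T by apply: bigmax_ge_id.
have TM : (T%:E <= M)%E.
  rewrite /T; elim/big_ind : _ => // [x y xM yM|i _]; last exact: MW.
  by rewrite EFin_max ge_max xM yM.
have c0 : 0 <= 2^-1 ^+ 18 * k%:R `^ (3 / 2) :> R.
  by rewrite mulr_ge0 ?powR_ge0 ?exprn_ge0.
have a0 : 0 <= n%:R * eps ^+ 2 * T.
  by rewrite mulr_ge0// mulr_ge0// exprn_ge0// ltW.
have d0 : 0 <= n%:R ^+ 2 * eps ^+ 4 / k%:R ^+ 3.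
  by rewrite divr_ge0 ?exprn_ge0 ?mulr_ge0// ?exprn_ge0// ltW.
have condT : n%:R * eps ^+ 2 * T <= 2^-1 ^+ 18 * k%:R `^ (3 / 2).
  have e2 : 0 < eps ^+ 2 by rewrite exprn_gt0.
  (* If [M = 0] then [T = 0]; if [M] is positive and finite, clear denominators; if [M] is infinite,
     its inverse is 0 and the hypothesis forces [n = 0]. *)
  case: M M0 TM nM {MW} => [r| |]//.
  - rewrite !lee_fin le_eqVlt => /orP[/eqP <- T0' _|r0 Tr].
      by rewrite (le_anti (introT andP (conj T0' T0))) mulr0.
    rewrite -EFinM inver mulf_eq0 (gt_eqF e2) (gt_eqF r0)/= -!EFinM lee_fin.
    rewrite mulrA.
    rewrite ler_pdivlMr ?mulr_gt0// mulrA; apply: le_trans.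
    by rewrite ler_wpM2l// mulr_ge0// ltW.
  - rewrite mulry gtr0_sg// mul1e invey !mule0 lee_fin => _ _ n0.
    have -> : n%:R = 0 :> R by apply/eqP; rewrite eq_le n0 ler0n.
    by rewrite !mul0r.
apply: (@le_trans _ _
  (2 ^+ 35 * (n%:R ^+ 2 * eps ^+ 4 / k%:R ^+ 3 * T ^+ 2))%:E).
  apply: inf_chi2_bound => // [i|i|]; first exact: Wch.
    exact: (le_bigmax _ (fun i => nuclear_norm (Hmx (W i)))).
  have -> : 2^-1 ^+ 36 * k%:R ^+ 3 = (2^-1 ^+ 18 * k%:R `^ (3 / 2)) ^+ 2 :> R.
    rewrite exprMn -exprM -[(_ `^ _) ^+ 2]powR_mulrn ?powR_ge0// -powRrM.
    by rewrite divfK// powR_mulrn// ltW.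
  by rewrite ler_pXn2r ?nnegrE.
rewrite EFinM lee_wpmul2l ?lee_fin ?exprn_ge0//.
rewrite EFinM lee_wpmul2l ?lee_fin//.
by rewrite expr2 EFinM lee_pmul.
Qed.
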